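(* For $m=2$: (1) there exist universal Maurer-Cartan elements $\omega\in\mathcal{MC}_2$ that are associative; (2) there is no universal Maurer-Cartan element $\omega\in\mathcal{MC}_2$ that is both associative and symmetric.
   Context: Over $\mathbb{R}$, let $\Omega=\bigoplus_{k\ge1,l}\Omega^k(l)$ be the bigraded vector space where $\Omega^{k}$ has as basis the words of length $k-1$ in the letters $a,b,c$; the empty word $e$ spans $\Omega^1$; a word in which $b$ occurs $r$ times has $l=-r$. Let $\diamond$ be concatenation. Structure maps: $w\circ w'=w\diamond c\diamond w'$; $d_i(e_1\cdots e_{k-1})=e_1\cdots e_{i-1}\,a\,e_i\cdots e_{k-1}$ for $1\le i\le k$ on $\Omega^k$; $\partial$ is the linear map with $\partial e=\partial a=\partial c=0$, $\partial b=c-a$, $\partial(w\diamond w')=\partial(w)\diamond w'+(-1)^{l(w)}w\diamond\partial(w')$. Put $L_1=e$, $L_n=b^{\diamond(n-1)}$ for $n\geq 2$. $\Omega_m=\Omega^{\boxtimes m}$, where $(\mathcal{A}\boxtimes\mathcal{B})^k(l)=\bigoplus_{i+j=l}\mathcal{A}^k(i)\otimes\mathcal{B}^k(j)$ with $\partial(a\boxtimes b)=\partial a\boxtimes b+(-1)^{l(a)}a\boxtimes\partial b$, $d_i(a\boxtimes b)=d_ia\boxtimes d_ib$, $(a\boxtimes b)\circ(a'\boxtimes b')=(-1)^{l(b)l(a')}(a\circ a')\boxtimes(b\circ b')$. $\bar\Omega_m$ is the DGA with $\bar\Omega_m^n=\prod_{k+l=n}\Omega_m^k(l)$, product $a\star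 b=(-1)^{k(a)|b|}a\circ b$ ($|b|=k(b)+l(b)$), differential $d_{\mathrm{tot}}=\partial+(-1)^n\sum_{i=1}^k(-1)^id_i$ on elements of total degree $n$ in $\Omega_m^k$. $\mathcal{MC}_m$ is the set of universal Maurer-Cartan elements of length $m$: elements $\omega=\omega_1+\omega_2+\cdots\in\bar\Omega_m^1$ ($\omega_k\in\Omega_m^k(1-k)$) with $d_{\mathrm{tot}}\omega+\omega\star\omega=0$ and $\omega_1=e^{\boxtimes m}$. Each $\omega\in\mathcal{MC}_m$ determines a unique linear map $\Delta_\omega:\Omega\to\Omega_m$ preserving both degrees and commuting with $\circ,\partial,d_i$, with $\Delta_\omega(L_n)=\omega_n$ for all $n$. $\omega\in\mathcal{MC}_2$ is associative if $(\Delta_\omega\boxtimes\mathrm{id})\circ\Delta_\omega=(\mathrm{id}\boxtimes\Delta_\omega)\circ\Delta_\omega$. It is symmetric if it is fixed by the flip $a_1\boxtimes a_2\mapsto(-1)^{l(a_1)l(a_2)}a_2\boxtimes a_1$. *)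

(* Defs.v *)
From HB Require Import structures.
From mathcomp Require Import all_boot all_order all_algebra.
From mathcomp Require Import finmap reals.
From mathcomp.multinomials Require Export monalg.

Set Implicit Arguments.
Unset Strict Implicit.
Unset Printing Implicit Defensive.

Import GRing.Theory.

Local Open Scope ring_scope.

Inductive letter := La | Lb | Lc.

Definition letter_code (x : letter) : option bool :=
  match x with La => None | Lb => Some false | Lc => Some true end.
Definition letter_decode (o : option bool) : letter :=
  match o with None => La | Some false => Lb | Some true => Lc end.
Lemma letter_codeK : cancel letter_code letter_decode.
Proof. by case. Qed.
HB.instance Definition _ := Countable.copy letter (can_type letter_codeK).

Notation word := (seq letter).

(* Bidegrees of a word: it lies in Omega^k(l) with k = arity, l = ldeg. *)
Definition arity (w : word) : nat := (size w).+1.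
Definition ldeg (w : word) : int := - (count_mem Lb w)%:Z.

Section Omega.
Context (R : realType).

(* Linear and bilinear extension of maps given on bases. *)
Definition lift (K : choiceType) (V : lmodType R) (f : K -> V)
    (x : {malg R[K]}) : V :=
  \sum_(k <- msupp x) x@_k *: f k.

Definition lift2 (K K' : choiceType) (V : lmodType R) (f : K -> K' -> V)
    (x : {malg R[K]}) (y : {malg R[K']}) : V :=
  lift (fun k => lift (f k) y) x.

Definition tens (K K' : choiceType) :
    {malg R[K]} -> {malg R[K']} -> {malg R[(K * K')%type]} :=
  lift2 (fun k k' => << (k, k') >>).

Definition tensmap (K1 K2 L1 L2 : choiceType)
    (f : {malg R[K1]} -> {malg R[L1]}) (g : {malg R[K2]} -> {malg R[L2]}) :
    {malg R[(K1 * K2)%type]} -> {malg R[(L1 * L2)%type]} :=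
  lift (fun p => tens (f << p.1 >>) (g << p.2 >>)).

Definition tensassoc (K1 K2 K3 : choiceType) :
    {malg R[(K1 * (K2 * K3))%type]} -> {malg R[(K1 * K2 * K3)%type]} :=
  lift (fun p => << (p.1, p.2.1, p.2.2) >>).

Definition sgn (l : int) : R := (-1) ^ l.

(* The algebra Omega; its piece Omega^k(l) is [inOmega k l]. *)

Definition Omega := {malg R[word]}.

Definition inOmega (k : nat) (l : int) (x : Omega) : Prop :=
  forall w, w \in msupp x -> arity w = k /\ ldeg w = l.

Definition diam : Omega -> Omega -> Omega := lift2 (fun u v => << u ++ v >>).

Definition circ (x y : Omega) : Omega := diam (diam x << [:: Lc] >>) y.

(* d_i, meaningful on Omega^k for 1 <= i <= k. *)
Definition face_word (i : nat) (w : word) : word :=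
  take i.-1 w ++ La :: drop i.-1 w.
Definition face (i : nat) : Omega -> Omega :=
  lift (fun w => << face_word i w >>).

Definition bd_letter (x : letter) : Omega :=
  if x is Lb then << [:: Lc] >> - << [:: La] >> else 0.

(* The graded Leibniz rule, applied to the factorization x :: w = x <> w. *)
Fixpoint bd_word (w : word) : Omega :=
  if w is x :: w' then
    diam (bd_letter x) << w' >>
      + sgn (ldeg [:: x]) *: diam << [:: x] >> (bd_word w')
  else 0.
Definition bd : Omega -> Omega := lift bd_word.

(* L n, for n >= 1. *)
Definition L (n : nat) : Omega := << nseq n.-1 Lb >>.

(* [Omega2] is the full tensor square of Omega; the box product Omega [x] Omega
   is its subspace (+)_(k, l) Omega2^k(l), with Omega2^k(l) given by
   [inOmega2 k l], in which both factors have the same arity k. *)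

Definition Omega2 := {malg R[(word * word)%type]}.

Definition inOmega2 (k : nat) (l : int) (x : Omega2) : Prop :=
  forall p, p \in msupp x ->
    [/\ arity p.1 = k, arity p.2 = k & ldeg p.1 + ldeg p.2 = l].

Definition circ2 : Omega2 -> Omega2 -> Omega2 :=
  lift2 (fun p q : word * word =>
    sgn (ldeg p.2 * ldeg q.1) *:
      tens (circ << p.1 >> << q.1 >>) (circ << p.2 >> << q.2 >>)).

Definition face2 (i : nat) : Omega2 -> Omega2 := tensmap (face i) (face i).

Definition bd2 : Omega2 -> Omega2 :=
  lift (fun p : word * word =>
    tens (bd << p.1 >>) << p.2 >>
      + sgn (ldeg p.1) *: tens << p.1 >> (bd << p.2 >>)).

Definition flip : Omega2 -> Omega2 :=
  lift (fun p : word * word => sgn (ldeg p.1 * ldeg p.2) *: << (p.2, p.1) >>).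

(* Elements of the DGA bar-Omega_2 are families x with x k in Omega_2^k; in
   total degree n this is [inbar n x].  Since arities are positive,
   [inbar n x] forces x 0 = 0. *)

Definition barOmega2 := nat -> Omega2.

Definition inbar (n : int) (x : barOmega2) : Prop :=
  forall k : nat, inOmega2 k (n - k%:Z) (x k).

(* a * b for b of total degree q. *)
Definition star (q : int) (x y : barOmega2) : barOmega2 := fun k =>
  \sum_(i < k.+1) sgn (i%:Z * q) *: circ2 (x i) (y (k - i)%N).

(* d_tot on total degree n; the faces d_1, ..., d_(k-1) of the arity k-1
   component contribute to the arity k component. *)
Definition dtot (n : int) (x : barOmega2) : barOmega2 := fun k =>
  bd2 (x k)
    + sgn n *: \sum_(1 <= i < k) (-1) ^+ i *: face2 i (x k.-1).

Definition MC2 (w : barOmega2) : Prop :=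
  [/\ inbar 1 w,
      forall k, dtot 1 w k + star 1 w w k = 0
    & w 1%N = tens << [::] >> << [::] >>].

(* D is the linear map Delta_w : Omega -> Omega_2 determined by w. *)
Record is_Delta (w : barOmega2) (D : {linear Omega -> Omega2}) : Prop := {
  Delta_deg : forall k l x, inOmega k l x -> inOmega2 k l (D x);
  Delta_circ : forall x y, D (circ x y) = circ2 (D x) (D y);
  Delta_bd : forall x, D (bd x) = bd2 (D x);
  Delta_face : forall k l i x, inOmega k l x -> (1 <= i <= k)%N ->
    D (face i x) = face2 i (D x);
  Delta_L : forall n, (1 <= n)%N -> D (L n) = w n
}.

(* Delta_w exists and is unique for every Maurer-Cartan element w, so the
   existential quantifier only serves to name it. *)
Definition is_associative (w : barOmega2) : Prop :=
  exists2 D : {linear Omega -> Omega2}, is_Delta w D &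
    forall x, tensmap D id (D x) = tensassoc (tensmap id D (D x)).

Definition is_symmetric (w : barOmega2) : Prop := forall k, flip (w k) = w k.

End Omega.

(* Main.v *)
From HB Require Import structures.
From mathcomp Require Import all_boot all_order all_algebra.
From mathcomp Require Import finmap reals ring.
From mathcomp Require Import zify.
Require Import Defs.

Set Implicit Arguments.
Unset Strict Implicit.
Unset Printing Implicit Defensive.

Import GRing.Theory.
Local Open Scope ring_scope.

(** A word of length k - 1 in the letters a, b, c is a cell of the cube of
    dimension k - 1: the letter b is the unit interval, a and c are its end
    points. A universal Maurer-Cartan element of length 2 is then a diagonal
    on cubical chains, compatible with all inclusions of faces, whose value
    on the top cube b...b is w_k.

    Existence. Serre's diagonal is multiplicative for concatenation and is
    given on letters by a |-> a [x] a, c |-> c [x] c, b |-> a [x] b + b [x]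
    c. Every word is built by prepending letters, so all its properties
    follow by induction once the structure maps are known to commute, up to
    explicit terms, with the operators [prep2 x y] that multiply on the left
    by x [x] y. For circ and the faces this is immediate. For the
    differential, the boundary of a [x] b + b [x] c is c [x] c - a [x] a
    because the mixed terms a [x] c cancel ([serre_bd_step]).
    Coassociativity reduces to the three letters ([serre_letter_coassoc]):
    both iterates send b to a [x] a [x] b + a [x] b [x] c + b [x] c [x] c.
    Finally, the Maurer-Cartan equation is the image under the diagonal of
    the formula for the boundary of the cube L_k in terms of its faces
    ([bd_L], [MC2_of_Delta]).

    Obstruction. For degree reasons w_2 is a combination of a [x] b, c [x]
    b, b [x] a and b [x] c; let al and ga be the coefficients of a [x] b and
    b [x] a. Comparing the coefficients of a [x] a in Delta(bd b) = bd(Delta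
    b) gives al + ga = 1, symmetry gives al = ga, and comparing the
    coefficients of a [x] a [x] b in the two iterates of Delta gives al = al
    ^ 2. The first two force al = 1/2, which contradicts the third. *)

(** * Linear extension from a basis *)

Section LinearExtension.
Context {R : realType}.
Implicit Types (K : choiceType) (U V W : lmodType R).

(** Enlarging the index set only adds zero terms, so any finite family of
    basis elements containing the support computes a linear extension. *)
Lemma lift_widen K V (f : K -> V) (x : {malg R[K]}) (s : seq K) :
  uniq s -> {subset msupp x <= s} -> lift f x = \sum_(k <- s) x@_k *: f k.
Proof.
move=> us sub; rewrite /lift [RHS](bigID (mem (msupp x))) /=.
rewrite [X in _ + X]big1 ?addr0 => [|k /mcoeff_outdom ->]; last exact: scale0r.
rewrite -[RHS]big_filter; apply: perm_big; apply: uniq_perm.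
- exact: fset_uniq.
- exact: filter_uniq.
- by move=> k; rewrite mem_filter /=; case: (boolP (k \in msupp x)) => // /sub.
Qed.

Lemma lift_is_linear K V (f : K -> V) : linear (lift f).
Proof.
move=> a x y; pose s := undup (msupp x ++ msupp y).
have us : uniq s by apply: undup_uniq.
have sx : {subset msupp x <= s} by move=> k; rewrite mem_undup mem_cat => ->.
have sy : {subset msupp y <= s}.
  by move=> k; rewrite mem_undup mem_cat orbC => ->.
rewrite !(lift_widen _ us) //; last first.
  move=> k; apply: contraTT; rewrite mem_undup mem_cat negb_or.
  rewrite -!mcoeff_eq0 mcoeffD mcoeffZ => /andP[/eqP-> /eqP->].
  by rewrite mulr0 addr0.
rewrite scaler_sumr -big_split /=; apply: eq_bigr => k _.
by rewrite mcoeffD mcoeffZ scalerDl scalerA.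
Qed.
HB.instance Definition _ K V (f : K -> V) :=
  GRing.isLinear.Build R {malg R[K]} V *:%R (lift f) (lift_is_linear f).

Lemma liftU K V (f : K -> V) k : lift f << k >> = f k.
Proof. by rewrite /lift msuppU oner_eq0 big_seq_fset1 mcoeffUU scale1r. Qed.

Lemma linear_lift K U V (g : {linear U -> V}) (f : K -> U) x :
  g (lift f x) = lift (fun k => g (f k)) x.
Proof. by rewrite /lift linear_sum; apply: eq_bigr => k _; rewrite linearZ. Qed.

Lemma lift_id K (x : {malg R[K]}) : lift (fun k => << k >>) x = x.
Proof.
rewrite [RHS]monalgE; apply: eq_bigr => k _; apply/malgP => k'.
by rewrite mcoeffZ !mcoeffU mulrnAr mulr1.
Qed.

Lemma linear_liftE K V (g : {linear {malg R[K]} -> V}) x :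
  g x = lift (fun k => g << k >>) x.
Proof. by rewrite -linear_lift lift_id. Qed.

Lemma eq_lift_supp K V (f g : K -> V) (x : {malg R[K]}) :
  {in msupp x, f =1 g} -> lift f x = lift g x.
Proof. by move=> e; apply: eq_big_seq => k /e ->. Qed.

(** Restricting to the support matters for the graded maps: many of the
    identities below hold on homogeneous elements only, because the Koszul
    sign they produce depends on the degree. *)
Lemma eq_linear_supp K V (f g : {malg R[K]} -> V) x :
  linear f -> linear g -> {in msupp x, forall k, f << k >> = g << k >>} ->
  f x = g x.
Proof.
move=> lf lg.
pose f' : {linear _ -> _} := HB.pack f (GRing.isLinear.Build R _ _ _ f lf).
pose g' : {linear _ -> _} := HB.pack g (GRing.isLinear.Build R _ _ _ g lg).
move=> e; rewrite -[f x]/(f' x) -[g x]/(g' x).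
rewrite [LHS]linear_liftE [RHS]linear_liftE.
exact: eq_lift_supp.
Qed.

Lemma eq_linear K V (f g : {malg R[K]} -> V) :
  linear f -> linear g -> (forall k, f << k >> = g << k >>) ->
  forall x, f x = g x.
Proof. by move=> lf lg e x; apply: eq_linear_supp => // k _. Qed.

Lemma linear_id U : linear (fun x : U => x). Proof. by []. Qed.
Lemma linear_D U V (f g : U -> V) :
  linear f -> linear g -> linear (fun x => f x + g x).
Proof. by move=> lf lg a x y; rewrite lf lg scalerDr addrACA. Qed.
Lemma linear_N U V (f : U -> V) : linear f -> linear (fun x => - f x).
Proof. by move=> lf a x y; rewrite lf opprD scalerN. Qed.
Lemma linear_scale U V (f : U -> V) (c : R) :
  linear f -> linear (fun x => c *: f x).
Proof. by move=> lf a x y; rewrite lf scalerDr !scalerA mulrC. Qed.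
Lemma linear_sumf U V I (s : seq I) (f : I -> U -> V) :
  (forall i, linear (f i)) -> linear (fun x => \sum_(i <- s) f i x).
Proof.
move=> lf a x y; rewrite scaler_sumr -big_split; apply: eq_bigr => i _.
exact: lf.
Qed.
Lemma linear_app U V W (g : {linear V -> W}) (f : U -> V) :
  linear f -> linear (fun x => g (f x)).
Proof. by move=> lf a x y; rewrite lf linearP. Qed.

Lemma msupp_lift K K' (f : K -> {malg R[K']}) x k' :
  k' \in msupp (lift f x) -> exists2 k, k \in msupp x & k' \in msupp (f k).
Proof.
rewrite /lift big_seq; elim/big_rec: _ => [|k y kx IH]; first by rewrite msupp0.
move=> /(fsubsetP (msuppD_le _ _)); rewrite in_fsetU.
case/orP=> [/(fsubsetP (msuppZ_le _ _))|/IH //].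
by exists k.
Qed.

Lemma lift2E K K' V (f : K -> K' -> V) x y :
  lift2 f x y = lift (fun k' => lift (f^~ k') x) y.
Proof.
rewrite /lift2 /lift; under eq_bigr do rewrite scaler_sumr.
rewrite exchange_big; apply: eq_bigr => k' _; rewrite scaler_sumr.
by apply: eq_bigr => k _; rewrite !scalerA mulrC.
Qed.

Lemma lift2U K K' V (f : K -> K' -> V) k k' : lift2 f << k >> << k' >> = f k k'.
Proof. by rewrite /lift2 !liftU. Qed.

Lemma linear_lift2l K K' U V (f : K -> K' -> V) y (g : U -> {malg R[K]}) :
  linear g -> linear (fun x => lift2 f (g x) y).
Proof. by move=> lg a x z; rewrite lg /lift2 linearP. Qed.
Lemma linear_lift2r K K' U V (f : K -> K' -> V) x (g : U -> {malg R[K']}) :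
  linear g -> linear (fun y => lift2 f x (g y)).
Proof. by move=> lg a y z; rewrite lg !lift2E linearP. Qed.

Lemma lift2_is_linear K K' V (f : K -> K' -> V) x : linear (lift2 f x).
Proof. exact: (linear_lift2r _ _ (@linear_id _)). Qed.
HB.instance Definition _ K K' V (f : K -> K' -> V) x :=
  GRing.isLinear.Build R {malg R[K']} V *:%R (lift2 f x) (lift2_is_linear f x).

Lemma lift2_0l K K' V (f : K -> K' -> V) y : lift2 f 0 y = 0.
Proof. exact: linear0. Qed.
Lemma lift2Zl K K' V (f : K -> K' -> V) a x y :
  lift2 f (a *: x) y = a *: lift2 f x y.
Proof. exact: linearZ. Qed.
Lemma lift2Dl K K' V (f : K -> K' -> V) x1 x2 y :
  lift2 f (x1 + x2) y = lift2 f x1 y + lift2 f x2 y.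
Proof. exact: linearD. Qed.
Lemma lift2Bl K K' V (f : K -> K' -> V) x1 x2 y :
  lift2 f (x1 - x2) y = lift2 f x1 y - lift2 f x2 y.
Proof. exact: linearB. Qed.
Lemma lift2_0r K K' V (f : K -> K' -> V) x : lift2 f x 0 = 0.
Proof. by rewrite lift2E linear0. Qed.
Lemma lift2Zr K K' V (f : K -> K' -> V) a x y :
  lift2 f x (a *: y) = a *: lift2 f x y.
Proof. by rewrite !lift2E linearZ. Qed.
Lemma lift2Dr K K' V (f : K -> K' -> V) x y1 y2 :
  lift2 f x (y1 + y2) = lift2 f x y1 + lift2 f x y2.
Proof. by rewrite !lift2E linearD. Qed.
Lemma lift2Br K K' V (f : K -> K' -> V) x y1 y2 :
  lift2 f x (y1 - y2) = lift2 f x y1 - lift2 f x y2.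
Proof. by rewrite !lift2E linearB. Qed.

Lemma linear_tensl K K' U (g : U -> {malg R[K]}) (y : {malg R[K']}) :
  linear g -> linear (fun x => tens (g x) y).
Proof. exact: linear_lift2l. Qed.
Lemma linear_tensr K K' U (g : U -> {malg R[K']}) (x : {malg R[K]}) :
  linear g -> linear (fun y => tens x (g y)).
Proof. exact: linear_lift2r. Qed.
Lemma linear_circ2l U (g : U -> Omega2 R) y :
  linear g -> linear (fun x => circ2 (g x) y).
Proof. exact: linear_lift2l. Qed.
Lemma linear_circ2r U (g : U -> Omega2 R) x :
  linear g -> linear (fun y => circ2 x (g y)).
Proof. exact: linear_lift2r. Qed.
Lemma linear_diaml U (g : U -> Omega R) y :
  linear g -> linear (fun x => diam (g x) y).
Proof. exact: linear_lift2l. Qed.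
Lemma linear_diamr U (g : U -> Omega R) x :
  linear g -> linear (fun y => diam x (g y)).
Proof. exact: linear_lift2r. Qed.

HB.instance Definition _ K K' (x : {malg R[K]}) :=
  GRing.Linear.copy (@tens R K K' x)
    (lift2 (fun (k : K) (k' : K') => << (k, k') >>) x).
HB.instance Definition _ (x : Omega R) :=
  GRing.Linear.copy (diam x) (lift2 (fun u v : word => << u ++ v >>) x).
HB.instance Definition _ (x : Omega2 R) :=
  GRing.Linear.copy (circ2 x) (lift2 (fun p q : word * word =>
    sgn R (ldeg p.2 * ldeg q.1) *:
      tens (circ << p.1 >> << q.1 >>) (circ << p.2 >> << q.2 >>)) x).

Lemma tensZl K K' a (x : {malg R[K]}) (y : {malg R[K']}) :
  tens (a *: x) y = a *: tens x y.
Proof. exact: lift2Zl. Qed.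
Lemma tensZr K K' a (x : {malg R[K]}) (y : {malg R[K']}) :
  tens x (a *: y) = a *: tens x y.
Proof. exact: lift2Zr. Qed.
Lemma tensBl K K' (x1 x2 : {malg R[K]}) (y : {malg R[K']}) :
  tens (x1 - x2) y = tens x1 y - tens x2 y.
Proof. exact: lift2Bl. Qed.
Lemma tensBr K K' (x : {malg R[K]}) (y1 y2 : {malg R[K']}) :
  tens x (y1 - y2) = tens x y1 - tens x y2.
Proof. exact: lift2Br. Qed.
Lemma tens_suml K K' I (s : seq I) (F : I -> {malg R[K]}) (y : {malg R[K']}) :
  tens (\sum_(i <- s) F i) y = \sum_(i <- s) tens (F i) y.
Proof.
exact: (big_morph (fun x => tens x y)
  (fun _ _ => lift2Dl _ _ _ _) (lift2_0l _ _)).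
Qed.
Lemma tens_sumr K K' I (s : seq I) (x : {malg R[K]}) (F : I -> {malg R[K']}) :
  tens x (\sum_(i <- s) F i) = \sum_(i <- s) tens x (F i).
Proof.
exact: (big_morph (tens x) (fun _ _ => lift2Dr _ _ _ _) (lift2_0r _ _)).
Qed.
Lemma circ2Zl a (x y : Omega2 R) : circ2 (a *: x) y = a *: circ2 x y.
Proof. exact: lift2Zl. Qed.
Lemma circ2_suml I (s : seq I) (F : I -> Omega2 R) y :
  circ2 (\sum_(i <- s) F i) y = \sum_(i <- s) circ2 (F i) y.
Proof.
exact: (big_morph (fun x => circ2 x y)
  (fun _ _ => lift2Dl _ _ _ _) (lift2_0l _ _)).
Qed.
End LinearExtension.

(** Linearity, in one argument, of an expression built from linear maps,
    [tens], [circ] and [circ2]. *)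
Ltac prove_linear := repeat match goal with
 | |- linear (fun x => x) => exact: linear_id
 | |- linear (fun x => GRing.add _ _) => apply: linear_D
 | |- linear (fun x => GRing.opp _) => apply: linear_N
 | |- linear (fun x => GRing.scale _ _) => apply: linear_scale
 | |- linear (fun x => bigop.body _ _ _) => apply: linear_sumf => ?
 | |- linear (fun x => tens _ _) =>
     first [apply: linear_tensl | apply: linear_tensr]
 | |- linear (fun x => diam _ _) =>
     first [apply: linear_diaml | apply: linear_diamr]
 | |- linear (fun x => circ _ _) => rewrite /circ
 | |- linear (fun x => circ2 _ _) =>
     first [apply: linear_circ2l | apply: linear_circ2r]
 | |- linear _ => first [apply: linear_app | exact: linearP]
 end.

(** * Prepending letters *)

Section PrependLetter.
Context {R : realType}.
Local Notation sg := (sgn R).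
Local Notation Omega := (Omega R).
Local Notation Omega2 := (Omega2 R).

Lemma sgn0 : sg 0 = 1. Proof. by rewrite /sgn expr0z. Qed.
Lemma sgnD l m : sg (l + m) = sg l * sg m.
Proof. by rewrite /sgn expfzDr // oppr_eq0 oner_eq0. Qed.
Lemma sgnN l : sg (- l) = sg l.
Proof. by case: l => n; rewrite /sgn ?NegzE ?opprK -exprnN invr_sign. Qed.
Lemma sgn1 : sg 1 = -1. Proof. by rewrite /sgn expr1z. Qed.
Lemma sgn_sqr l : sg l * sg l = 1.
Proof. by rewrite -{2}sgnN -sgnD subrr sgn0. Qed.
Lemma sgn_nat n : sg n%:Z = (-1) ^+ n. Proof. by []. Qed.

HB.instance Definition _ := GRing.Linear.copy (@bd R) (lift (@bd_word R)).
HB.instance Definition _ i :=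
  GRing.Linear.copy (@face R i) (lift (fun w => << face_word i w >>)).
HB.instance Definition _ K1 K2 L1 L2 f g :=
  GRing.Linear.copy (@tensmap R K1 K2 L1 L2 f g)
    (lift (fun p => tens (f << p.1 >>) (g << p.2 >>))).
HB.instance Definition _ K1 K2 K3 :=
  GRing.Linear.copy (@tensassoc R K1 K2 K3)
    (lift (fun p => << (p.1, p.2.1, p.2.2) >>)).
HB.instance Definition _ i :=
  GRing.Linear.copy (@face2 R i) (tensmap (@face R i) (face i)).
HB.instance Definition _ := GRing.Linear.copy (@bd2 R)
  (lift (fun p : word * word =>
    tens (bd << p.1 >>) << p.2 >>
      + sg (ldeg p.1) *: tens << p.1 >> (bd << p.2 >>))).
HB.instance Definition _ := GRing.Linear.copy (@flip R)
  (lift (fun p : word * word => sg (ldeg p.1 * ldeg p.2) *: << (p.2, p.1) >>)).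

Lemma ldeg_cons x w : ldeg (x :: w) = ldeg [:: x] + ldeg w.
Proof. by rewrite /ldeg /= addn0 PoszD opprD. Qed.

(** The prepending operators are locked because comparing two of them with
    different letters must not unfold them into sums over supports. *)
Fact prep_key : unit. Proof. by []. Qed.
Definition prep (x : letter) : Omega -> Omega :=
  locked_with prep_key (lift (fun w => << x :: w >>)).
Lemma prepE x : prep x = lift (fun w => << x :: w >>).
Proof. exact: unlock. Qed.
Lemma prep_is_linear x : linear (prep x).
Proof. by move=> a u v; rewrite prepE linearP. Qed.
HB.instance Definition _ x :=
  GRing.isLinear.Build R Omega Omega *:%R (prep x) (prep_is_linear x).

(** Left multiplication by x [x] y for concatenation in Omega [x] Omega: the
    Koszul sign comes from moving y past the first word. *)
Definition prep2 (x y : letter) : Omega2 -> Omega2 :=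
  locked_with prep_key (lift (fun p =>
    sg (ldeg [:: y] * ldeg p.1) *: << (x :: p.1, y :: p.2) >>)).
Lemma prep2E x y : prep2 x y =
  lift (fun p => sg (ldeg [:: y] * ldeg p.1) *: << (x :: p.1, y :: p.2) >>).
Proof. exact: unlock. Qed.
Lemma prep2_is_linear x y : linear (prep2 x y).
Proof. by move=> a u v; rewrite prep2E linearP. Qed.
HB.instance Definition _ x y :=
  GRing.isLinear.Build R Omega2 Omega2 *:%R (prep2 x y) (prep2_is_linear x y).

Definition Omega3 := {malg R[(word * word * word)%type]}.
(** Here y moves past the first word, and z past the first two. *)
Definition prep3 (x y z : letter) : Omega3 -> Omega3 :=
  locked_with prep_key (lift (fun p =>
    sg (ldeg [:: y] * ldeg p.1.1 + ldeg [:: z] * (ldeg p.1.1 + ldeg p.1.2))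
      *: << (x :: p.1.1, y :: p.1.2, z :: p.2) >>)).
Lemma prep3E x y z : prep3 x y z = lift (fun p : word * word * word =>
    sg (ldeg [:: y] * ldeg p.1.1 + ldeg [:: z] * (ldeg p.1.1 + ldeg p.1.2))
      *: << (x :: p.1.1, y :: p.1.2, z :: p.2) >>).
Proof. exact: unlock. Qed.
Lemma prep3_is_linear x y z : linear (prep3 x y z).
Proof. by move=> a u v; rewrite prep3E linearP. Qed.
HB.instance Definition _ x y z :=
  GRing.isLinear.Build R Omega3 Omega3 *:%R (prep3 x y z)
    (prep3_is_linear x y z).

Lemma prepU x w : prep x << w >> = << x :: w >>.
Proof. by rewrite prepE liftU. Qed.
Lemma prep2U x y p : prep2 x y << p >> =
  sg (ldeg [:: y] * ldeg p.1) *: << (x :: p.1, y :: p.2) >>.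
Proof. by rewrite prep2E liftU. Qed.
Lemma prep3U x y z p : prep3 x y z << p >> =
  sg (ldeg [:: y] * ldeg p.1.1 + ldeg [:: z] * (ldeg p.1.1 + ldeg p.1.2))
      *: << (x :: p.1.1, y :: p.1.2, z :: p.2) >>.
Proof. by rewrite prep3E liftU. Qed.
Lemma bdU w : bd << w >> = bd_word R w.
Proof. exact: liftU. Qed.
Lemma tensU (K K' : choiceType) (k : K) (k' : K') :
  tens << k >> << k' >> = << (k, k') >> :> {malg R[_]}.
Proof. exact: lift2U. Qed.
Lemma faceU i w : face i << w >> = << face_word i w >> :> Omega.
Proof. exact: liftU. Qed.
Lemma face2U i p :
  face2 i << p >> = << (face_word i p.1, face_word i p.2) >> :> Omega2.
Proof. by rewrite /face2 /tensmap liftU !faceU tensU. Qed.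
Lemma bd2U p : bd2 << p >> =
  tens (bd << p.1 >>) << p.2 >>
  + sg (ldeg p.1) *: tens << p.1 >> (bd << p.2 >>).
Proof. exact: liftU. Qed.
Lemma circU u v : circ << u >> << v >> = << u ++ Lc :: v >> :> Omega.
Proof. by rewrite /circ /diam !lift2U -catA. Qed.
Lemma circ2U p q : circ2 << p >> << q >> =
  sg (ldeg p.2 * ldeg q.1) *: << (p.1 ++ Lc :: q.1, p.2 ++ Lc :: q.2) >>.
Proof. by rewrite /circ2 lift2U !circU tensU. Qed.

Lemma diam_letter x z : diam << [:: x] >> z = prep x z.
Proof. by rewrite prepE /diam /lift2 liftU. Qed.

Lemma bd_prep x w : x != Lb -> bd << x :: w >> = prep x (bd << w >>).
Proof.
case: x => // _;
  by rewrite !bdU /= diam_letter /diam lift2_0l add0r sgn0 scale1r.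
Qed.

Lemma bd_prep_b w :
  bd << Lb :: w >> = << Lc :: w >> - << La :: w >> - prep Lb (bd << w >>).
Proof.
rewrite !bdU /= diam_letter /diam lift2Bl !lift2U /=.
by rewrite /ldeg /= sgnN sgn1 scaleN1r.
Qed.

Lemma msupp_bd w v : v \in msupp (bd << w >> : Omega) -> ldeg v = ldeg w + 1.
Proof.
elim: w v => [|x w IH] v; first by rewrite bdU /= msupp0.
have prepP y : v \in msupp (prep y (bd << w >>)) ->
    ldeg v = ldeg [:: y] + ldeg w + 1.
  rewrite prepE => /msupp_lift [v' /IH e].
  by rewrite msuppU oner_eq0 in_fset1 => /eqP ->; rewrite ldeg_cons e addrA.
rewrite [ldeg (x :: w)]ldeg_cons.
have [->|xb] := eqVneq x Lb; last by rewrite (bd_prep _ xb) => /prepP.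
rewrite bd_prep_b => /(fsubsetP (msuppB_le _ _)); rewrite in_fsetU.
move=> /orP[|/prepP //] /(fsubsetP (msuppB_le _ _)).
rewrite in_fsetU !msuppU oner_eq0 !in_fset1.
by move=> /orP[] /eqP ->; rewrite /ldeg /=; lia.
Qed.

(** Associativity of concatenation, with the Koszul signs. *)
Lemma circ2_prep2 x y P Q :
  circ2 (prep2 x y P) Q = prep2 x y (circ2 P Q).
Proof.
move: P; apply: eq_linear => [||p]; [prove_linear|prove_linear|].
move: Q; apply: eq_linear => [||q]; [prove_linear|prove_linear|].
rewrite prep2U circ2Zl !circ2U [in RHS]linearZ /= prep2U !scalerA -!sgnD.
apply: (congr1 (fun l => sg l *: _)).
by rewrite /ldeg /= !count_cat /= !PoszD; ring.
Qed.

Lemma circ2_unit Q : circ2 << ([::], [::]) >> Q = prep2 Lc Lc Q.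
Proof.
move: Q; apply: eq_linear => [||q]; [prove_linear|prove_linear|].
by rewrite circ2U prep2U.
Qed.

Lemma ldeg_face i w : ldeg (face_word i w) = ldeg w.
Proof.
by rewrite -[in RHS](cat_take_drop i.-1 w) /ldeg !count_cat /=.
Qed.

Lemma face_word1 w : face_word 1 w = La :: w.
Proof. by rewrite /face_word /= take0 drop0. Qed.

Lemma face2_1 P : face2 1 P = prep2 La La P.
Proof.
move: P; apply: eq_linear => [||p]; [prove_linear|prove_linear|].
by rewrite face2U prep2U !face_word1 /ldeg /= oppr0 mul0r sgn0 scale1r.
Qed.

(** The face d_(i+2) inserts its letter a beyond the first position, and a
    has degree 0, so neither the prepended letters nor the sign are
    affected. *)
Lemma face2_prep2 i x y (P : Omega2) :
  face2 i.+2 (prep2 x y P) = prep2 x y (face2 i.+1 P).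
Proof.
move: P; apply: eq_linear => [||p]; [prove_linear|prove_linear|].
by rewrite prep2U linearZ /= !face2U prep2U /= ldeg_face.
Qed.

(** The sign is constant on the support only when [P] is homogeneous; the
    use is for the boundary of a word. *)
Lemma tens_prepl x y (P : Omega) v n : {in msupp P, forall u, ldeg u = n} ->
  tens (prep x P) << y :: v >> =
  sg (ldeg [:: y] * n) *: prep2 x y (tens P << v >>).
Proof.
move=> Pn.
apply: (eq_linear_supp (f := fun P => tens (prep x P) _)
   (g := fun P => _ *: prep2 x y (tens P _))); [prove_linear|prove_linear|].
move=> u /Pn <-.
by rewrite prepU !tensU prep2U scalerA sgn_sqr scale1r.
Qed.

Lemma tens_prepr x y u (Q : Omega) :
  tens << x :: u >> (prep y Q) =
  sg (ldeg [:: y] * ldeg u) *: prep2 x y (tens << u >> Q).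
Proof.
move: Q; apply: eq_linear => [||v]; [prove_linear|prove_linear|].
by rewrite prepU !tensU prep2U scalerA sgn_sqr scale1r.
Qed.

Lemma ldeg_nil : ldeg [::] = 0. Proof. by []. Qed.
Lemma ldeg_b : ldeg [:: Lb] = -1. Proof. by []. Qed.

Lemma ldeg_flat x w : x != Lb -> ldeg (x :: w) = ldeg w.
Proof. by case: x. Qed.

Lemma sgn_flat x l : x != Lb -> sg (ldeg [:: x] * l) = 1.
Proof. by move=> xb; rewrite ldeg_flat // ldeg_nil mul0r sgn0. Qed.

Lemma sgn_b l : sg (ldeg [:: Lb] * l) = sg l.
Proof. by rewrite ldeg_b mulN1r sgnN. Qed.

(** This lemma and the next two are the Leibniz rule for left multiplication
    by x [x] y, in the cases where neither letter, only y, or only x is the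
    interval b; the case b [x] b does not occur in the Serre diagonal. *)
Lemma bd2_prep2_flat x y (P : Omega2) : x != Lb -> y != Lb ->
  bd2 (prep2 x y P) = prep2 x y (bd2 P).
Proof.
move=> xb yb.
move: P; apply: eq_linear => [||[u v]]; [prove_linear|prove_linear|].
rewrite prep2U linearZ /= !bd2U /= !bd_prep // tens_prepr.
have unit_signs (V : lmodType R) (A B : V) (s : R) :
  1 *: (1 *: A + s *: (1 *: B)) = A + s *: B by rewrite !scale1r.
rewrite (tens_prepl _ _ _ (@msupp_bd u)) (ldeg_flat _ xb) !sgn_flat //.
by rewrite unit_signs [in RHS]linearD linearZ.
Qed.

Lemma bd2_prep2_b x (P : Omega2) : x != Lb ->
  bd2 (prep2 x Lb P) = prep2 x Lc P - prep2 x La P - prep2 x Lb (bd2 P).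
Proof.
move=> xb.
move: P; apply: eq_linear => [||[u v]]; [prove_linear|prove_linear|].
rewrite prep2U linearZ /= !bd2U /= bd_prep // bd_prep_b !tensBr tens_prepr.
rewrite (tens_prepl _ _ _ (@msupp_bd u)) (ldeg_flat _ xb) !tensU !prep2U /=.
rewrite !sgn_b !sgn_flat // sgnD sgn1.
rewrite [prep2 _ _ (_ + _)]linearD /= [prep2 _ _ (_ *: _)]linearZ /=.
have clear_signs (V : lmodType R) (A B C D : V) (s : R) : s * s = 1 ->
    s *: ((s * -1) *: A + s *: (C - D - s *: B)) =
    1 *: C - 1 *: D - (A + s *: B).
  move=> ss; rewrite scalerDr !scalerA mulrA ss mul1r scaleN1r !scale1r.
  by rewrite addrC opprD [- A - _]addrC addrA.
by rewrite clear_signs; last exact: sgn_sqr.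
Qed.

Lemma bd2_prep2_bl y (P : Omega2) : y != Lb ->
  bd2 (prep2 Lb y P) = prep2 Lc y P - prep2 La y P - prep2 Lb y (bd2 P).
Proof.
move=> yb.
move: P; apply: eq_linear => [||[u v]]; [prove_linear|prove_linear|].
rewrite prep2U linearZ /= !bd2U /= bd_prep_b bd_prep // !tensBl tens_prepr.
rewrite (tens_prepl _ _ _ (@msupp_bd u)) (ldeg_cons Lb u) !tensU !prep2U /=.
rewrite ldeg_b !sgn_flat // !(sgnD, sgnN) sgn1.
rewrite [prep2 _ _ (_ + _)]linearD /= [prep2 _ _ (_ *: _)]linearZ /=.
have clear_signs (V : lmodType R) (A B C D : V) (s : R) :
    1 *: (C - D - 1 *: A + (-1 * s) *: (1 *: B)) =
    1 *: C - 1 *: D - (A + s *: B).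
  by rewrite !scale1r mulN1r scaleNr opprD addrA.
by rewrite clear_signs.
Qed.

End PrependLetter.

(** * The Serre diagonal *)

Section SerreDiagonal.
Context {R : realType}.
Local Notation sg := (sgn R).
Local Notation Omega := (Omega R).
Local Notation Omega2 := (Omega2 R).

(** The terms of the Serre diagonal of a letter; for b it is the path
    through the square that first runs along a [x] b and then along b [x] c. *)
Definition serre_letter (x : letter) : seq (letter * letter) :=
  match x with
  | La => [:: (La, La)]
  | Lb => [:: (La, Lb); (Lb, Lc)]
  | Lc => [:: (Lc, Lc)]
  end.

Fixpoint serre_word (w : word) : Omega2 :=
  if w is x :: w' then
    \sum_(q <- serre_letter x) prep2 q.1 q.2 (serre_word w')
  else << ([::], [::]) >>.

Definition serre : Omega -> Omega2 := lift serre_word.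
HB.instance Definition _ := GRing.Linear.copy serre (lift serre_word).

Lemma serreU w : serre << w >> = serre_word w.
Proof. exact: liftU. Qed.

Lemma serre_cons x z :
  serre (prep x z) = \sum_(q <- serre_letter x) prep2 q.1 q.2 (serre z).
Proof.
move: z; apply: eq_linear => [||w]; [prove_linear|prove_linear|].
by rewrite prepU !serreU.
Qed.

Lemma serre_consU x w : serre << x :: w >> =
  \sum_(q <- serre_letter x) prep2 q.1 q.2 (serre << w >> : Omega2).
Proof. by rewrite !serreU. Qed.

Lemma serre_prep_b (P : Omega) :
  serre (prep Lb P) = prep2 La Lb (serre P) + prep2 Lb Lc (serre P).
Proof. by rewrite serre_cons /= big_cons big_seq1. Qed.

Lemma serre_prep_flat x (P : Omega) : x != Lb ->
  serre (prep x P) = prep2 x x (serre P).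
Proof. by case: x => // _; rewrite serre_cons /= big_seq1. Qed.

Lemma serre_letter_deg x q : q \in serre_letter x ->
  ldeg [:: q.1] + ldeg [:: q.2] = ldeg [:: x].
Proof. by case: x q => -[[] []]. Qed.

Lemma msupp_serre w p : p \in msupp (serre << w >>) ->
  [/\ arity p.1 = arity w, arity p.2 = arity w & ldeg p.1 + ldeg p.2 = ldeg w].
Proof.
rewrite serreU; elim: w p => [|x w IH] p /=.
  by rewrite msuppU oner_eq0 in_fset1 => /eqP ->.
(* The induction runs over sublists of the terms of the diagonal of x. *)
suff : forall s, {subset s <= serre_letter x} ->
    p \in msupp (\sum_(q <- s) prep2 q.1 q.2 (serre_word w)) ->
  [/\ arity p.1 = arity (x :: w), arity p.2 = arity (x :: w)
    & ldeg p.1 + ldeg p.2 = ldeg (x :: w)] by apply.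
elim=> [|q s IHs] sub; first by rewrite big_nil msupp0.
rewrite big_cons => /(fsubsetP (msuppD_le _ _)); rewrite in_fsetU => /orP[].
  rewrite prep2E => /msupp_lift [r /IH [r1 r2 rl]] /(fsubsetP (msuppZ_le _ _)).
  rewrite msuppU oner_eq0 in_fset1 => /eqP -> /=.
  have /serre_letter_deg ql := sub q (mem_head _ _).
  rewrite ldeg_cons (ldeg_cons _ r.2) (ldeg_cons _ w) -ql -rl addrACA.
  split=> //.
    by move: r1; rewrite /arity /= => ->.
  by move: r2; rewrite /arity /= => ->.
by apply: IHs => r rs; apply: sub; rewrite inE rs orbT.
Qed.

Lemma serre_circ x y : serre (circ x y) = circ2 (serre x) (serre y).
Proof.
move: x; apply: eq_linear => [||u]; [prove_linear|prove_linear|].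
move: y; apply: eq_linear => [||v]; [prove_linear|prove_linear|].
rewrite circU !serreU; elim: u => [|x u IH] /=.
  by rewrite big_seq1 circ2_unit.
by rewrite circ2_suml; apply: eq_bigr => q _; rewrite circ2_prep2 IH.
Qed.

Lemma serre_face i (x : Omega) : (0 < i)%N ->
  serre (face i x) = face2 i (serre x).
Proof.
move=> i0; move: x; apply: eq_linear => [||w]; [prove_linear|prove_linear|].
rewrite faceU !serreU; elim: w i i0 => [|x w IH] [|[|i]] // _ /=.
- by rewrite big_seq1 -face2_1.
- by rewrite big_seq1 prep2U face2U /= sgn0 scale1r.
- by rewrite big_seq1 -face2_1.
rewrite linear_sum; apply: eq_bigr => q _ /=.
by rewrite face2_prep2 -IH.
Qed.

(** The boundary of a [x] b contributes a [x] c - a [x] a, that of b [x] c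
    contributes c [x] c - a [x] c, and the corner a [x] c cancels. *)
Lemma serre_bd_step (P : Omega2) :
  bd2 (prep2 La Lb P + prep2 Lb Lc P) =
  prep2 Lc Lc P - prep2 La La P - (prep2 La Lb (bd2 P) + prep2 Lb Lc (bd2 P)).
Proof.
have telescope (V : lmodType R) (A B C D E : V) :
  (B - A - D) + (C - B - E) = C - A - (D + E).
  by rewrite addrACA -opprD; congr (_ - _); rewrite addrC addrA subrK.
rewrite linearD /=.
(* The cancelling term is a [x] c. *)
apply: etrans (telescope _ (prep2 La La P) (prep2 La Lc P) _ _ _).
apply: (congr2 +%R).
  exact: bd2_prep2_b.
exact: bd2_prep2_bl.
Qed.

Lemma serre_bd (x : Omega) : serre (bd x) = bd2 (serre x).
Proof.
move: x; apply: eq_linear => [||w]; [prove_linear|prove_linear|].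
elim: w => [|x w IH].
  rewrite bdU linear0 serreU bd2U /= !bdU /= /tens.
  by rewrite lift2_0l lift2_0r scaler0 addr0.
have [-> {x}|xb] := eqVneq x Lb; last first.
  rewrite (bd_prep _ xb) -[<< x :: w >>]prepU !(serre_prep_flat _ xb) IH.
  by rewrite bd2_prep2_flat.
have serre_b : serre << Lb :: w >> =
    prep2 La Lb (serre << w >>) + prep2 Lb Lc (serre << w >> : Omega2).
  by rewrite -prepU serre_prep_b.
apply: etrans (esym (etrans (congr1 _ serre_b) (serre_bd_step _))).
rewrite -IH; apply: etrans (congr1 _ (bd_prep_b w)) _.
rewrite [LHS]linearB [X in X - _ = _]linearB /=.
apply: (congr2 (fun P Q => P - Q)); last exact: serre_prep_b.
by apply: (congr2 (fun P Q => P - Q)); rewrite -prepU; apply: serre_prep_flat.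
Qed.

(** The signs of [prep2] for the letters q and of prepending y to the last
    word combine to that of [prep3] when [P] is homogeneous of degree n; the
    diagonal of a word is, of the degree of that word. *)
Lemma tens_prep2l q y v (P : Omega2) n :
  {in msupp P, forall p, ldeg p.1 + ldeg p.2 = n} ->
  sg (ldeg [:: y] * n) *: tens (prep2 q.1 q.2 P) << y :: v >> =
  prep3 q.1 q.2 y (tens P << v >>).
Proof.
move=> Pn.
apply: (eq_linear_supp (f := fun P => _ *: tens (prep2 q.1 q.2 P) _)
   (g := fun P => prep3 q.1 q.2 y (tens P _))); [prove_linear|prove_linear|].
move=> p /Pn <-.
by rewrite prep2U tensZl !tensU prep3U scalerA -sgnD addrC.
Qed.

(** The scalar on the left is the sign of prepending to u [x] v a pair x [x]
    y such that the degree of y is that of r.1 [x] r.2, a term of its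
    diagonal. *)
Lemma assoc_prep2r x r u (Q : Omega2) :
  tensassoc (sg ((ldeg [:: r.1] + ldeg [:: r.2]) * ldeg u) *:
    tens << x :: u >> (prep2 r.1 r.2 Q)) =
  prep3 x r.1 r.2 (tensassoc (tens << u >> Q)).
Proof.
move: Q; apply: eq_linear => [||p]; [prove_linear|prove_linear|].
rewrite prep2U tensZr !tensU linearZ /= linearZ /= /tensassoc !liftU prep3U /=.
rewrite scalerA -sgnD.
apply: (congr1 (fun l => sg l *: _)); ring.
Qed.

Lemma assoc_left_prep2 x y (P : Omega2) :
  tensmap serre id (prep2 x y P) =
  \sum_(q <- serre_letter x) prep3 q.1 q.2 y (tensmap serre id P).
Proof.
move: P; apply: eq_linear => [||[u v]]; [prove_linear|prove_linear|].
rewrite prep2U linearZ /= /tensmap !liftU /= serre_consU tens_suml scaler_sumr.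
apply: eq_bigr => q _; apply: tens_prep2l => p /msupp_serre [] //.
Qed.

Lemma assoc_right_prep2 x y (P : Omega2) :
  tensassoc (tensmap id serre (prep2 x y P)) =
  \sum_(r <- serre_letter y)
    prep3 x r.1 r.2 (tensassoc (tensmap id serre P)).
Proof.
move: P; apply: eq_linear => [||[u v]]; [prove_linear|prove_linear|].
rewrite prep2U linearZ /= /tensmap !liftU /= serre_consU tens_sumr.
rewrite scaler_sumr linear_sum big_seq [RHS]big_seq.
apply: eq_bigr => r /serre_letter_deg <-; exact: assoc_prep2r.
Qed.

(** Both iterates of the diagonal send b to a [x] a [x] b + a [x] b [x] c +
    b [x] c [x] c; the family [F] stands for the operators [prep3]. *)
Lemma serre_letter_coassoc x (V : zmodType)
    (F : letter -> letter -> letter -> V) :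
  \sum_(s <- serre_letter x) \sum_(q <- serre_letter s.1) F q.1 q.2 s.2 =
  \sum_(s <- serre_letter x) \sum_(r <- serre_letter s.2) F s.1 r.1 r.2.
Proof. by case: x; rewrite /= !(big_cons, big_nil) /= ?addr0 ?addrA. Qed.

Lemma serre_coassoc (x : Omega) :
  tensmap serre id (serre x) =
  tensassoc (tensmap id serre (serre x)).
Proof.
move: x; apply: eq_linear => [||w]; [prove_linear|prove_linear|].
elim: w => [|x w IH].
  by rewrite serreU /= /tensmap !liftU /= serreU /= !tensU /tensassoc liftU.
rewrite serre_consU [LHS]linear_sum [tensmap id _ _]linear_sum /=.
rewrite [tensassoc _]linear_sum /=.
under eq_bigr do rewrite assoc_left_prep2 IH.
under [RHS]eq_bigr do rewrite assoc_right_prep2.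
exact: (serre_letter_coassoc x (fun x1 x2 x3 =>
  prep3 x1 x2 x3 (tensassoc (tensmap id serre (serre << w >>))))).
Qed.

End SerreDiagonal.

(** * Maurer-Cartan elements from diagonals *)

Section MaurerCartan.
Context {R : realType}.
Local Notation sg := (sgn R).
Local Notation Omega := (Omega R).
Local Notation Omega2 := (Omega2 R).

Lemma circL i j :
  circ (L R i.+1) (L R j.+1) = << nseq i Lb ++ Lc :: nseq j Lb >>.
Proof. exact: circU. Qed.

Lemma faceL i n : (i < n)%N ->
  face i.+1 (L R n) = << nseq i Lb ++ La :: nseq (n.-1 - i) Lb >>.
Proof.
case: n => // n lt_in; rewrite faceU /face_word /=.
by rewrite take_nseq ?drop_nseq.
Qed.

(** The boundary of a cube: in direction i.+1 the face at the end point c is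
    a product of two smaller cubes, and the face at a is a d_(i.+1). *)
Lemma bd_L n : bd (L R n.+1) =
  \sum_(i < n) (-1) ^+ i *: (circ (L R i.+1) (L R (n - i)) - face i.+1 (L R n)).
Proof.
elim: n => [|n IH]; first by rewrite bdU big_ord0.
rewrite big_ord_recl expr0 scale1r subn0 circL faceL // subn0.
apply: etrans (bd_prep_b (nseq n Lb)) _; congr (_ + _).
rewrite -[<< _ >>]/(L R n.+1) IH linear_sum -sumrN.
apply: eq_bigr => -[i lt_in] _.
rewrite linearZ /= exprS mulN1r scaleNr; congr (- (_ *: _)).
rewrite linearB /bump /= add1n subSS.
have -> : (n - i)%N = (n - i).-1.+1 by rewrite prednK // subn_gt0.
rewrite !circL !faceL // !prepU /=.
by congr (_ - << Lb :: _ ++ La :: nseq _ Lb >>); lia.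
Qed.

Lemma inOmega_L n : (0 < n)%N -> inOmega n (1 - n%:Z) (L R n).
Proof.
case: n => // n _ w; rewrite msuppU oner_eq0 in_fset1 => /eqP ->.
rewrite /arity size_nseq /ldeg count_nseq /= mul1n; split=> //.
by rewrite -[n.+1]addn1 PoszD opprD addrCA subrr addr0.
Qed.

(** The Maurer-Cartan equation in arity n.+1 is the image under D of the
    formula [bd_L]: D turns the faces at c into the products of [star] and
    the faces at a into those of [dtot]. *)
Lemma MC2_of_Delta (w : barOmega2 R) (D : {linear Omega -> Omega2}) :
  is_Delta w D -> w 0%N = 0 -> w 1%N = tens << [::] >> << [::] >> -> MC2 w.
Proof.
move=> wD w0 w1; split=> //.
  case=> [|k]; first by rewrite w0 => p; rewrite msupp0.
  by rewrite -(Delta_L wD) //; apply: (Delta_deg wD); apply: inOmega_L.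
have circ20l x : circ2 0 x = 0 :> Omega2 by apply: lift2_0l.
have circ20r x : circ2 x 0 = 0 :> Omega2 by apply: lift2_0r.
case=> [|n]; rewrite /dtot /star.
  by rewrite big_ord1 big_geq // scaler0 w0 linear0 circ20l scaler0 !addr0.
have -> : bd2 (w n.+1) = \sum_(i < n)
    (-1) ^+ i *: (circ2 (w i.+1) (w (n - i)%N) - face2 i.+1 (w n)).
  rewrite -(Delta_L wD) // -(Delta_bd wD) bd_L linear_sum.
  apply: eq_bigr => i _; rewrite linearZ /= linearB /=.
  have n0 : (0 < n)%N := leq_ltn_trans (leq0n _) (ltn_ord i).
  congr (_ *: _); apply: (congr2 (fun P Q => P - Q)).
    apply: etrans (Delta_circ wD _ _) _.
    by apply: congr2; apply: (Delta_L wD); rewrite ?subn_gt0.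
  apply: etrans (Delta_face wD (inOmega_L n0) _) _; first by rewrite /=.
  exact: congr1 (Delta_L wD n0).
(* In star, the terms with a factor of arity 0 vanish. *)
rewrite big_add1 big_mkord big_ord_recl w0 circ20l scaler0 add0r.
rewrite big_ord_recr /= /bump /= add1n subnn w0 circ20r scaler0 addr0.
rewrite sgn1 scaleN1r -sumrN -!big_split big1 //= => i _.
have cancel_terms (V : lmodType R) (A B : V) (s : R) :
  s *: (A - B) - (- s) *: B + (- s) *: A = 0.
  by rewrite scalerBr !scaleNr opprK subrK subrr.
rewrite add1n subSS mulr1 sgn_nat exprS mulN1r.
exact: cancel_terms.
Qed.

Definition serre_MC : barOmega2 R :=
  fun n => if n is 0 then 0 else serre (L R n).

Lemma serre_is_Delta : is_Delta serre_MC serre.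
Proof.
split.
- move=> k l x xkl p /msupp_lift [w /xkl [<- <-]] pw.
  by apply: msupp_serre; rewrite serreU; exact: pw.
- exact: serre_circ.
- exact: serre_bd.
- by move=> k l i x _ /andP[i0 _]; apply: serre_face.
- by case.
Qed.

Lemma serre_MC_associative : MC2 serre_MC /\ is_associative serre_MC.
Proof.
split; last by exists serre; [exact: serre_is_Delta | exact: serre_coassoc].
by apply: (MC2_of_Delta serre_is_Delta); rewrite //= serreU tensU.
Qed.

End MaurerCartan.

(** * The obstruction to symmetry *)

Section Obstruction.
Context {R : realType}.
Local Notation sg := (sgn R).
Local Notation Omega := (Omega R).
Local Notation Omega2 := (Omega2 R).

Lemma linear_mcoeff (K : choiceType) (U : lmodType R) (g : U -> {malg R[K]}) k :
  linear g -> linear (fun x => (g x)@_k : R^o).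
Proof. by move=> lg a x y; rewrite lg mcoeffD mcoeffZ. Qed.

Lemma mcoeff_tens (K K' : choiceType) (x : {malg R[K]}) (y : {malg R[K']})
    k k' :
  (tens x y)@_(k, k') = x@_k * y@_k'.
Proof.
move: x; apply: (@eq_linear R K R^o (fun x => (tens x y)@_(k, k'))
  (fun x => x@_k * y@_k')) => [||u].
- by apply: linear_mcoeff; prove_linear.
- by move=> a x z; rewrite mcoeffD mcoeffZ mulrDl -mulrA.
move: y; apply: (@eq_linear R K' R^o (fun y => (tens << u >> y)@_(k, k'))
  (fun y => << u >>@_k * y@_k')) => [||v].
- by apply: linear_mcoeff; prove_linear.
- move=> a x z; rewrite mcoeffD mcoeffZ mulrDr; congr (_ + _).
  by rewrite mulrCA.
by rewrite tensU !mcoeffU xpair_eqE -natrM mulnb.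
Qed.

Lemma mcoeff_tensassoc (K1 K2 K3 : choiceType)
    (x : {malg R[(K1 * (K2 * K3))%type]}) k1 k2 k3 :
  (tensassoc x)@_(k1, k2, k3) = x@_(k1, (k2, k3)).
Proof.
move: x; apply: (@eq_linear R _ R^o (fun x => (tensassoc x)@_(k1, k2, k3))
  (fun x => x@_(k1, (k2, k3)))) => [||[u1 [u2 u3]]].
- by apply: linear_mcoeff; prove_linear.
- by move=> a x z; rewrite mcoeffD mcoeffZ.
by rewrite /tensassoc liftU !mcoeffU !xpair_eqE andbA.
Qed.

(** The basis of Omega2^2(-1): exactly one of the two letters is b. *)
Definition degree_m1 : seq (word * word) :=
  [:: ([:: La], [:: Lb]); ([:: Lc], [:: Lb]);
      ([:: Lb], [:: La]); ([:: Lb], [:: Lc])].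

Lemma inOmega2_2m1 (x : Omega2) :
  inOmega2 2 (-1) x -> {subset msupp x <= degree_m1}.
Proof.
move=> hx [u v] /hx [] /=.
case: u => [|a [|]] // _; case: v => [|b [|]] // _.
by case: a b => [] [].
Qed.

(** A linear map on Omega2^2(-1) is determined by four values. The
    coefficients are abstracted, and the values given by equations, so that
    a coefficient of the image can be read off from those of the images of
    the basis. *)
Lemma linear_degree_m1 (x : Omega2) : inOmega2 2 (-1) x ->
  exists al be ga de : R, x@_([:: La], [:: Lb]) = al /\
    forall (K : choiceType) (f : {linear Omega2 -> {malg R[K]}}) k a b c d,
      (f << ([:: La], [:: Lb]) >>)@_k = a ->
      (f << ([:: Lc], [:: Lb]) >>)@_k = b ->
      (f << ([:: Lb], [:: La]) >>)@_k = c ->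
      (f << ([:: Lb], [:: Lc]) >>)@_k = d ->
    (f x)@_k = al * a + be * b + ga * c + de * d.
Proof.
move=> /inOmega2_2m1 hx.
exists x@_([:: La], [:: Lb]), x@_([:: Lc], [:: Lb]),
  x@_([:: Lb], [:: La]), x@_([:: Lb], [:: Lc]); split=> // K f k.
move=> _ _ _ _ <- <- <- <-.
rewrite [f x]linear_liftE.
rewrite (lift_widen (fun p => f << p >>) (s := degree_m1) _ hx) //.
rewrite raddf_sum (eq_bigr (fun p => x@_p * (f << p >>)@_k)) => [|p _].
  rewrite /degree_m1 !big_cons big_nil.
  have regroup (a b c d : R) : a + (b + (c + (d + 0))) = a + b + c + d.
    by rewrite addr0 !addrA.
  exact: regroup.
exact: mcoeffZ.
Qed.

Lemma mcoeff_bd2 u v k k' :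
  (bd2 << (u, v) >>)@_(k, k') =
  (bd << u >>)@_k * << v >>@_k' + sg (ldeg u) * (<< u >>@_k * (bd << v >>)@_k').
Proof.
rewrite bd2U mcoeffD; apply: congr2; first exact: mcoeff_tens.
by apply: etrans (mcoeffZ _ _ _) _; apply: congr1; apply: mcoeff_tens.
Qed.

Lemma mcoeff_tensmapU (K K' : choiceType) (f : Omega -> {malg R[K]})
    (g : Omega -> {malg R[K']}) (u v : word) (k : K) (k' : K') :
  (tensmap f g << (u, v) >>)@_(k, k') = (f << u >>)@_k * (g << v >>)@_k'.
Proof. by rewrite /tensmap liftU mcoeff_tens. Qed.

Lemma mcoeff_bd_letter x : (bd << [:: x] >>)@_[:: La] = - (x == Lb)%:R :> R.
Proof.
have [->|xb] := eqVneq x Lb.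
  by rewrite bd_prep_b bdU linear0 subr0 mcoeffB !mcoeffU sub0r.
by rewrite bd_prep // bdU linear0 mcoeff0 oppr0.
Qed.

Lemma mcoeff_letter x y : (<< [:: x] >> : Omega)@_[:: y] = (x == y)%:R.
Proof. by rewrite mcoeffU; case: x y => [] []. Qed.

Lemma mcoeff_bd2_letters x y :
  (bd2 << ([:: x], [:: y]) >>)@_([:: La], [:: La]) =
  - (x == Lb)%:R * (y == La)%:R
  + sg (ldeg [:: x]) * ((x == La)%:R * - (y == Lb)%:R).
Proof.
apply: etrans (mcoeff_bd2 _ _ _ _) _.
apply: congr2; first by
  apply: congr2; [exact: mcoeff_bd_letter | exact: mcoeff_letter].
apply: congr1.
by apply: congr2; [exact: mcoeff_letter | exact: mcoeff_bd_letter].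
Qed.

Section AssociativeSymmetric.
Context (w : barOmega2 R) (D : {linear Omega -> Omega2}).
Context (wMC : MC2 w) (wD : is_Delta w D).

Lemma w2_degree : inOmega2 2 (-1) (w 2).
Proof. by case: wMC => /(_ 2%N). Qed.

Lemma D_e : D << [::] >> = << ([::], [::]) >>.
Proof.
by have := Delta_L wD (n := 1) isT; case: wMC => _ _ -> ->; rewrite tensU.
Qed.

(** The letter a is the face d_1 of e, and the letter c is e circ e, so D is
    forced on both. *)
Lemma D_a : D << [:: La] >> = << ([:: La], [:: La]) >>.
Proof.
have e_deg := @inOmega_L R 1 isT.
have := Delta_face wD (i := 1) e_deg isT.
by rewrite /L /= faceU D_e face2U.
Qed.

Lemma D_c : D << [:: Lc] >> = << ([:: Lc], [:: Lc]) >>.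
Proof.
have := Delta_circ wD << [::] >> << [::] >>.
by rewrite circU D_e circ2U /= mul0r sgn0 scale1r.
Qed.

Lemma D_b : D << [:: Lb] >> = w 2.
Proof. exact: (Delta_L wD (n := 2) isT). Qed.

Lemma bd2_w2 : bd2 (w 2) = << ([:: Lc], [:: Lc]) >> - << ([:: La], [:: La]) >>.
Proof.
rewrite -D_b -(Delta_bd wD) (bd_prep_b [::]) bdU /= linear0 subr0.
by rewrite linearB /= D_a D_c.
Qed.

(** The coefficient al of a [x] b in w_2 = D b would be 1/2 by symmetry and
    compatibility with the differential, but must be idempotent by
    coassociativity. *)
Lemma associative_not_symmetric :
  (forall x, tensmap D id (D x) = tensassoc (tensmap id D (D x))) ->
  flip (w 2) = w 2 -> False.
Proof.
move=> w_assoc w_sym.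
have [al [be [ga [de [w2_al w2E]]]]] := linear_degree_m1 w2_degree.
(* Coefficient of a [x] a in the boundary of w_2. *)
have sum1 : - (al + ga) = -1.
  have : (bd2 (w 2))@_([:: La], [:: La]) = 0 - 1 :> R.
    rewrite bd2_w2; apply: etrans (mcoeffB _ _ _) _.
    by rewrite !mcoeffU /= mulr0n mulr1n.
  rewrite (w2E _ _ _ _ _ _ _ (mcoeff_bd2_letters _ _) (mcoeff_bd2_letters _ _)
    (mcoeff_bd2_letters _ _) (mcoeff_bd2_letters _ _)) /=.
  rewrite sub0r => <-.
  rewrite -[ldeg [:: La]]/(0 : int) sgn0; ring.
have sym : ga = al.
  have flipE x y : (flip << ([:: x], [:: y]) >>)@_([:: La], [:: Lb]) =
      sg (ldeg [:: x] * ldeg [:: y])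
        * (([:: y], [:: x]) == ([:: La], [:: Lb]))%:R :> R.
    apply: etrans (congr1 _ (liftU _ _)) _; apply: etrans (mcoeffZ _ _ _) _.
    by rewrite mcoeffU.
  rewrite -w2_al -w_sym.
  rewrite (w2E _ _ _ _ _ _ _ (flipE _ _) (flipE _ _)
    (flipE _ _) (flipE _ _)) /=.
  rewrite -[ldeg [:: La]]/(0 : int) mulr0 sgn0; ring.
(* Coefficient of a [x] a [x] b in the two iterates of D on b. *)
have idem : al = al * al.
  have := congr1 (mcoeff ([:: La], [:: La], [:: Lb])) (w_assoc << [:: Lb] >>).
  rewrite mcoeff_tensassoc [in tensmap D _ _]D_b [in tensmap id _ _]D_b.
  have left_coef x y X : (D << [:: x] >>)@_([:: La], [:: La]) = X ->
      (tensmap D id << ([:: x], [:: y]) >>)@_([:: La], [:: La], [:: Lb]) =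
      X * (y == Lb)%:R.
    move=> <-; apply: etrans (mcoeff_tensmapU _ _ _ _ _ _) _.
    exact: congr1 (mcoeff_letter _ _).
  have right_coef x y Y : (D << [:: y] >>)@_([:: La], [:: Lb]) = Y ->
      (tensmap id D << ([:: x], [:: y]) >>)@_([:: La], ([:: La], [:: Lb])) =
      (x == La)%:R * Y.
    move=> <-; apply: etrans (mcoeff_tensmapU _ _ _ _ _ _) _.
    by apply: congr2 => //; apply: mcoeff_letter.
  have Da_aa : (D << [:: La] >>)@_([:: La], [:: La]) = 1 :> R.
    by rewrite D_a mcoeffUU.
  have Dc_aa : (D << [:: Lc] >>)@_([:: La], [:: La]) = 0 :> R.
    by rewrite D_c mcoeffU.
  have Db_ab : (D << [:: Lb] >>)@_([:: La], [:: Lb]) = al by rewrite D_b.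
  rewrite (w2E _ _ _ _ _ _ _ (left_coef _ _ _ Da_aa) (left_coef _ _ _ Dc_aa)
    (left_coef _ _ _ erefl) (left_coef _ _ _ erefl)).
  rewrite (w2E _ _ _ _ _ _ _ (right_coef _ _ _ Db_ab) (right_coef _ _ _ Db_ab)
    (right_coef _ _ _ erefl) (right_coef _ _ _ erefl)) /=.
  by rewrite !(mulr1, mul1r, mulr0, mul0r, addr0).
have two_al : al + al = 1 by rewrite -[1]opprK -sum1 opprK sym.
have al0 : al = 0.
  have : al * (al + al) = al by rewrite two_al mulr1.
  rewrite mulrDr -!idem => /(congr1 (fun x => x - al)).
  by rewrite addrK subrr.
by move: two_al; rewrite al0 addr0 => /eqP; rewrite eq_sym oner_eq0.
Qed.

End AssociativeSymmetric.

End Obstruction.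

Theorem corollary5p7 (R : realType) :
  (exists w : barOmega2 R, MC2 w /\ is_associative w) /\
  ~ (exists w : barOmega2 R, [/\ MC2 w, is_associative w & is_symmetric w]).
Proof.
split; first by exists serre_MC; apply: serre_MC_associative.
move=> [w [wMC [D wD Dassoc] /(_ 2%N)]].
exact: (associative_not_symmetric wMC wD Dassoc).
Qed.
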